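(* Let $N\geq 2$ and let $p,q>N$ be integers with $\gcd(N,p)=\gcd(N,q)=1$. Put $d=\gcd(p,q)$ and let $w(B)$ be the writhe number of the minimal braid $B$ associated with $(N,p,q)$. Then $$|w(B)|\leq d(N-1).\qquad ( * )$$ Equality is attained in $( * )$ if and only if $2N$ divides $p+q$ or $p-q$. Otherwise $$|w(B)|\leq d(N-3).$$
   Context: Minimal braid: let $\eta>0$ be a very small irrational number and let $\varepsilon\in\mathbb{R}$ (the phase; the basic choice is $\varepsilon=0$). For $k=0,\dots,N-1$ let $$B_k:[\eta,1+\eta]\to\mathbb{R}^2,\quad B_k(t)=(x_k(t),y_k(t))=\Bigl(\sin\bigl(\tfrac{2\pi}{N}q(t+k)\bigr),\ \cos\bigl(\tfrac{2\pi}{N}p(t+k+\varepsilon)\bigr)\Bigr).$$ The phase $\varepsilon$ is such that $B_0(t),\dots,B_{N-1}(t)$ are pairwise distinct for every $t$. The $B_k$ are the strands of a closed $N$-braid $B$ in $\mathbb{S}^1\times\mathbb{R}^2$; up to mirror symmetry, its isotopy type does not depend on the phase. A crossing point of $B$ is a triple $(k,l,t)$ with $0\leq k<l\leq N-1$ and $t\in[\eta,1+\eta]$ such that $x_k(t)=x_l(t)$. Its sign in $\{-1,+1\}$ is the usual sign of a braid crossing, namely the sign of $(x_k'(t)-x_l'(t))(y_k(t)-y_l(t))$; with this convention all crossing points are positive in the torus knot case $p=q$, $\varepsilon=0$. The writhe number $w(B)$ is the sum of the signs of all crossing points of $B$.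
   Formalization: Equality is shown to hold iff 2N divides p+q or p-q and also 2d divides p+q; ''otherwise'' negates this. The extra condition (automatic for d odd) is needed: for N=3, p=4, q=8, phase 0, 2N divides p+q but w(B)=0, not ±8. *)

(* Defs.v *)
From HB Require Import structures.
From mathcomp Require Import all_boot all_order all_algebra.
From mathcomp Require Import all_classical all_reals all_analysis.

Set Implicit Arguments.
Unset Strict Implicit.
Unset Printing Implicit Defensive.
Import Order.TTheory GRing.Theory Num.Theory.
Import numFieldNormedType.Exports.
Local Open Scope classical_set_scope.
Local Open Scope ring_scope.

Section MinimalBraid.
Context {R : realType}.
Variables (N p q : nat) (eps eta : R).

Definition strand_x (k : 'I_N) (t : R) : R :=
  sin (2 * pi / N%:R * (q%:R * (t + k%:R))).

Definition strand_y (k : 'I_N) (t : R) : R :=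
  cos (2 * pi / N%:R * (p%:R * (t + k%:R + eps))).

(* The formulas make sense for every real [t]; the braid is their restriction
   to the window [`[eta, 1 + eta]]. *)
Definition strand (k : 'I_N) (t : R) : R * R := (strand_x k t, strand_y k t).

Definition admissible_phase : Prop :=
  forall t : R, t \in `[eta, 1 + eta] ->
  injective (fun k : 'I_N => strand k t).

Definition crossing_points : set ('I_N * 'I_N * R) :=
  [set c : 'I_N * 'I_N * R |
    [/\ (c.1.1 < c.1.2)%N,
        c.2 \in `[eta, 1 + eta] &
        strand_x c.1.1 c.2 = strand_x c.1.2 c.2]].

Definition crossing_sign (c : 'I_N * 'I_N * R) : int :=
  let: (k, l, t) := c in
  sgz (((strand_x k)^`()%classic t - (strand_x l)^`()%classic t)
       * (strand_y k t - strand_y l t)).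

(* [\sum_(c \in A) F c] is the sum over the finite support of [F] in [A] (and
   [0] if the support is infinite); here [crossing_points] is finite as soon
   as [q] is prime to [N]. *)
Definition writhe : int := \sum_(c \in crossing_points) crossing_sign c.

End MinimalBraid.

(* Main.v *)
Require Import Defs.
From mathcomp Require Import all_boot all_order all_algebra.
From mathcomp Require Import all_classical all_reals all_analysis.
From mathcomp Require Import zify ring lra.
Import Order.TTheory GRing.Theory Num.Theory.
Local Open Scope ring_scope.

(* Strands [k < l] cross exactly at the times [t] with
   [2 t + k + l = N (2 m + 1) / (2 q)], and the sign of that crossing factors as
   [c j * f m], where [j = l - k], [c j] is the sign of
   [sin (pi p j / N) sin (pi q j / N)], and
   [f m = (-1)^m sgn sin (pi p (2 m + 1) / (2 q) + phase)].  The windows of [m]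
   belonging to [j] and to [N - j] together cover one period [2 q] of [f], so
   [2 w = (sum of the c j) * (sum of f over 2 q consecutive integers)].

   Write [p = d p'] and [q = d q'].  If [p' + q'] is odd, [f] is antiperiodic
   and its sum vanishes.  Otherwise [f] runs [2 d] times through the alternating
   signs of [q'] equidistant angles, [q'] odd, in a half circle, so that its sum
   is [2 d] or [- 2 d].

   Hence [|w| = d |sum of the N - 1 signs c j|], which equals [d (N - 1)] if
   the [c j] agree and is at most [d (N - 3)] otherwise.  That the [c j] agree
   means that [p j] and [q j] modulo [2 N] lie always in the same, or always in
   opposite, halves; dividing by [q] this forces [p = q] or [p = - q] modulo
   [2 N]. *)

(** * Sums of signs and parities of floors *)

(** As soon as two of the signs differ, such a pair cancels and only [size r - 2] signs remain. The
    empty list falls under the first alternative. *)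
Lemma sum_signs (I : eqType) (r : seq I) (c : I -> int) :
  {in r, forall i, `|c i| = 1} ->
  (exists2 e : int, `|e| = 1 & {in r, forall i, c i = e}) \/
  `|\sum_(i <- r) c i| <= (size r)%:Z - 2.
Proof.
elim: r => [|x r IHr] c1; first by left; exists 1.
have cx : `|c x| = 1 by apply: c1; rewrite mem_head.
have [|[e e1 ce]|lec] := IHr; first by move=> i ir; apply: c1; rewrite inE ir orbT.
- have [ex|/eqP nex] := eqVneq (c x) e.
    by left; exists e => // i; rewrite inE => /orP[/eqP->|/ce].
  case: r c1 ce {IHr} => [|y r] c1 ce.
    by left; exists (c x) => // i; rewrite inE => /eqP->.
  right; rewrite big_cons (eq_big_seq (fun=> e)) // big_const_seq count_predT.
  rewrite iter_addr_0 /= -mulr_natr natz.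
  have [] : e = 1 \/ e = -1 by lia.
  - by move=> e_1; rewrite e_1 in nex *; lia.
  - by move=> e_1; rewrite e_1 in nex *; lia.
- right; rewrite big_cons (le_trans (ler_normD _ _)) // cx; move: lec => /=; lia.
Qed.

Section FloorParity.
Local Open Scope nat_scope.

Lemma odd_divnDM (N a b : nat) : 0 < N ->
  odd ((a + 2 * N * b) %/ N) = odd (a %/ N).
Proof.
by move=> N0; rewrite mulnAC divnDMl // oddD oddM addbF.
Qed.

Lemma odd_divn_mod (N a : nat) : 0 < N ->
  odd (a %% (2 * N) %/ N) = odd (a %/ N).
Proof.
move=> N0; rewrite [in RHS](divn_eq a (2 * N)) addnC (mulnC _ (2 * N)).
by rewrite odd_divnDM.
Qed.

Lemma coprime_Ndvd (N p j : nat) : coprime N p -> 0 < j < N -> ~~ (N %| p * j).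
Proof.
move=> cNp /andP[j0 jN]; rewrite Gauss_dvdr //.
by apply/negP => /(dvdn_leq j0); rewrite leqNgt jN.
Qed.

(** The remainders of [a] and [b] are not both zero, and their sum is a multiple of [N] below [2 N],
    hence [N] itself; this costs one unit of [m]. *)
Lemma divn_reflect (N a b m : nat) : 0 < N -> ~~ (N %| a) -> a + b = N * m ->
  a %/ N + b %/ N = m.-1.
Proof.
move=> N0 Na abm.
have : 0 < a %% N by rewrite lt0n.
have := divn_eq a N; have := divn_eq b N.
have := ltn_pmod a N0; have := ltn_pmod b N0.
set x := a %/ N; set y := b %/ N; set u := a %% N; set v := b %% N.
move=> vN uN eb ea u0.
have e : N * m = N * (x + y) + (u + v) by lia.
have : m = (x + y).+1.
  by apply/eqP; rewrite eqn_leq; apply/andP; split; nia.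
by move=> ->.
Qed.

(** If [1 < r < N], the multiples of [r] advance by less than [N] and cannot jump over the interval
    from [N] to [2 N], where the floor is [1]; if [r >= N], then [j = 1] already lands there. *)
Lemma even_floor_one (N r : nat) : odd r -> r < 2 * N -> 1 < N -> coprime N r ->
  (forall j, 0 < j < N -> ~~ odd (r * j %/ N)) -> r = 1.
Proof.
move=> or r2 N1 cNr ev.
have rN : r < N.
  rewrite ltnNge; apply/negP => Nr.
  have := ev 1 N1; rewrite muln1.
  suff -> : r %/ N = 1 by [].
  by apply/eqP; rewrite eqn_leq -ltnS ltn_divLR ?leq_divRL ?mul1n //; lia.
apply/eqP/negPn/negP => r1.
have r3 : 2 < r by case: r or r1 {r2 rN cNr ev} => [|[|[|]]].
(* The index of the first multiple of [r] beyond [N]; [r >= 3] keeps it below [N]. *)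
have /ev : 0 < (N %/ r).+1 < N.
  have := leq_trunc_div N r; rewrite ltnS leq0n /=; nia.
suff -> : r * (N %/ r).+1 %/ N = 1 by [].
have := divn_eq N r; have : N %% r < r by rewrite ltn_pmod //; lia.
have : N %% r != 0.
  apply/negP => /dvdnP [z Nz]; move: cNr; rewrite Nz coprimeMl.
  by rewrite /coprime gcdnn (negbTE r1) andbF.
move=> ? ? ?.
by apply/eqP; rewrite eqn_leq -ltnS ltn_divLR ?leq_divRL ?mul1n; nia.
Qed.

(* Dividing by [q] in [Z/2N] reduces to [q = 1]. *)
Lemma even_floor_eqmod_odd (N p q : nat) : 1 < N -> odd p -> odd q ->
  coprime N p -> coprime N q ->
  (forall j, 0 < j < N -> odd (p * j %/ N) = odd (q * j %/ N)) ->
  p = q %[mod 2 * N].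
Proof.
move=> N1 op oq cp cq H.
have N0 : 0 < N by lia.
(* Adding [N] to [j] changes the two floors by the odd numbers [p] and [q], so both parities flip
   together. *)
have Hj j : ~~ (N %| j) -> odd (p * j %/ N) = odd (q * j %/ N).
  move=> Nj; rewrite (divn_eq j N) addnC !mulnDr !mulnA !divnDMl // !oddD !oddM op oq.
  by rewrite H // ltn_pmod // lt0n Nj.
have q0 : 0 < q by lia.
have cq2 : coprime q (2 * N).
  by rewrite coprime_sym coprimeMl coprime2n oq.
(* [u] inverts [q] modulo [2 N], so that [r] represents [p / q]. *)
case: (egcdnP (2 * N) q0) => u v; rewrite (eqP cq2) => uv _.
set r := (p * u) %% (2 * N).
have cuN : coprime N u.
  rewrite coprime_sym; apply/coprimeP; first by case: u uv {r} => //; lia.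
  by exists (q, 2 * v) => /=; lia.
have ou : odd u.
  by have := congr1 odd uv; rewrite oddD !oddM /= andbF; case: (odd u).
have r1 : r = 1.
  apply: even_floor_one N1 _ _ => //.
  - by rewrite /r odd_mod ?oddM ?op ?ou.
  - by rewrite /r ltn_pmod; lia.
  - have : coprime N (p * u) by rewrite coprimeMr cp.
    rewrite (divn_eq (p * u) (2 * N)) -/r mulnA => c.
    by rewrite /coprime -(gcdnMDl (p * u %/ (2 * N) * 2)).
  (* [Hj] at [u * j] trades [p] for [q], and [q * u * j] is [j] modulo [2 N], whose floor is [0]. *)
  - move=> j jN; rewrite -odd_divn_mod // modnMml odd_divn_mod //.
    rewrite -mulnA Hj; last by apply: coprime_Ndvd; rewrite // coprime_sym.
    rewrite mulnA (mulnC q) uv mulnDl mul1n addnC mulnC mulnA mulnC.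
    rewrite odd_divnDM // divn_small //; lia.
have -> : p %% (2 * N) = p * (u * q) %% (2 * N).
  by rewrite uv mulnDr muln1 (mulnA p v) modnMDl.
by rewrite mulnA -modnMml -/r r1 mul1n.
Qed.

(** If [p] and [q] are even, then [N] is odd; adding [N] to both makes them odd and raises both
    floors by [j]. *)
Lemma even_floor_eqmod (N p q : nat) : 1 < N -> odd p = odd q ->
  coprime N p -> coprime N q ->
  (forall j, 0 < j < N -> odd (p * j %/ N) = odd (q * j %/ N)) ->
  p = q %[mod 2 * N].
Proof.
move=> N1; case op: (odd p) => /esym oq cp cq H.
  exact: even_floor_eqmod_odd.
have N0 : 0 < N by lia.
have oN : odd N.
  apply/negPn/negP => eN; move: cp; rewrite /coprime => /eqP g1.
  have : 2 %| gcdn N p by rewrite dvdn_gcd !dvdn2 op eN.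
  by rewrite g1.
apply/eqP; rewrite -(eqn_modDr N); apply/eqP.
apply: even_floor_eqmod_odd; rewrite ?oddD ?op ?oq ?oN //.
- by rewrite /coprime gcdnDr.
- by rewrite /coprime gcdnDr.
by move=> j jN; rewrite !mulnDl (mulnC N) !divnDMl // !oddD H.
Qed.

(** Comparing [j = 1] with [j = N - 1] shows that [p] and [q] have the same parity. The case of odd
    sums is then reduced to that of even sums by passing from [p] to [- p]. *)
Lemma floor_parity_const (N p q : nat) : 1 < N -> coprime N p -> coprime N q ->
  (exists b, forall j, 0 < j < N -> odd (p * j %/ N + q * j %/ N) = b) <->
  (2 * N %| p + q \/ p = q %[mod 2 * N]).
Proof.
move=> N1 cp cq; have N0 : 0 < N by lia.
have pos_coprime m : coprime N m -> 0 < m.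
  by case: m => //; rewrite /coprime gcdn0; lia.
have odd_pred m : 0 < m -> odd m.-1 = ~~ odd m.
  by case: m => //= m _; rewrite negbK.
have refl p' j : coprime N p' -> 0 < j < N ->
    p' * j %/ N + p' * (N - j) %/ N = p'.-1.
  move=> c jN; rewrite (@divn_reflect N _ _ p') ?coprime_Ndvd //.
  by rewrite -mulnDr subnKC 1?mulnC //; lia.
split=> [[b Hb]|[/dvdnP[z pq]|pq]].
- have opq : odd p = odd q.
    have j1 : 0 < 1 < N by lia.
    have jn : 0 < N - 1 < N by lia.
    have := congr1 odd (refl _ _ cp j1); have := congr1 odd (refl _ _ cq j1).
    have := Hb _ j1; have := Hb _ jn.
    rewrite !oddD !odd_pred ?pos_coprime //.
    by do 4![case: odd] => <- //; do 2![case: odd].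
  case: b Hb => Hb; last first.
    right; apply: even_floor_eqmod => // j /Hb.
    by rewrite oddD; case: odd; case: odd.
  (* A natural number standing for [- p] modulo [2 N]; by reflection its floors have the parity
     opposite to those of [p]. *)
  left; have p2 : 2 * N * p - p = q %[mod 2 * N].
    have pp : p <= 2 * N * p by nia.
    apply: even_floor_eqmod => //.
    + by rewrite oddB // !oddM.
    + have -> : 2 * N * p - p = (N.-1 + N) * p by nia.
      by rewrite coprimeMr cp andbT /coprime gcdnDr -/(coprime _ _) coprimenP.
    move=> j jN; have := Hb j jN.
    have -> : (2 * N * p - p) * j %/ N = (2 * p * j).-1 - p * j %/ N.
      rewrite -(@divn_reflect N (p * j) ((2 * N * p - p) * j) (2 * p * j)) //.
      * by rewrite addKn.
      * by rewrite coprime_Ndvd.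
      * nia.
    have : p * j %/ N < 2 * p * j.
      rewrite ltn_divLR //; have := pos_coprime _ cp; nia.
    move=> lt; rewrite oddD oddB; last by rewrite -ltnS prednK //; exact: leq_ltn_trans (leq0n _) lt.
    rewrite odd_pred ?oddM //; last exact: leq_ltn_trans (leq0n _) lt.
    by case: odd; case: odd.
  have /eqP := p2; rewrite -(eqn_modDl p) subnKC; last by nia.
  by rewrite modnMr eq_sym.
- exists true => j jN; rewrite (@divn_reflect N _ _ (2 * z * j)) ?coprime_Ndvd //.
    case: z pq => [|z] pq; last by case: j jN => //=; lia.
    have := pos_coprime _ cp.
    lia.
  by rewrite -mulnDl pq; lia.
- exists false => j _; rewrite oddD -(odd_divn_mod N (p * j)) //.
  by rewrite -modnMml pq modnMml odd_divn_mod // addbb.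
Qed.

End FloorParity.

(** * Sums over windows of integers *)

Section NatSums.
Implicit Types (F c : nat -> int) (a : nat -> nat) (n P q m : nat).

Lemma sum_period1 F P n : (forall m, F (m + P)%N = F m) ->
  \sum_(n <= m < n + P) F m = \sum_(0 <= m < P) F m.
Proof.
move=> FP; elim: n => // n <-.
have [->|P0] := posnP P; first by rewrite !addn0 !big_geq.
rewrite [RHS]big_ltn ?addSn; last by lia.
by rewrite big_nat_recr /= ?FP 1?addrC //; lia.
Qed.

Lemma sum_period F P n k : (forall m, F (m + P)%N = F m) ->
  \sum_(n <= m < n + k * P) F m = k%:Z * \sum_(0 <= m < P) F m.
Proof.
move=> FP; elim: k => [|k IHk]; first by rewrite mul0n addn0 big_geq ?mul0r.
rewrite (big_cat_nat (n := (n + k * P)%N)) ?leq_addr ?leq_add2l ?leq_mul2r ?leqnSn ?orbT //=.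
by rewrite mulSnr addnA (sum_period1 F P (n + k * P)) // IHk -addn1 PoszD mulrDl mul1r.
Qed.

Lemma sum_antiperiod F P n k : (forall m, F (m + P)%N = - F m) ->
  \sum_(n <= m < n + k * (P + P)) F m = 0.
Proof.
move=> FP; rewrite sum_period; last by move=> m; rewrite addnA !FP opprK.
rewrite (big_cat_nat (n := P)) ?leq_addr //=.
rewrite -{2}(add0n P) big_addn addnK -big_split /= big1 ?mulr0 // => m _.
by rewrite FP subrr.
Qed.

(** Multiplication by [u] permutes the residues modulo [P]. *)
Lemma sum_period_coprime F P u : coprime P u -> (forall m, F (m + P)%N = F m) ->
  \sum_(0 <= m < P) F (u * m)%N = \sum_(0 <= m < P) F m.
Proof.
move=> cPu FP; have [->|P0] := posnP P; first by rewrite !big_geq.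
have Fmod m : F (m %% P)%N = F m.
  rewrite [in RHS](divn_eq m P) addnC; elim: (m %/ P)%N => [|k IHk]; first by rewrite addn0.
  by rewrite mulSnr addnA FP.
transitivity (\sum_(m <- [seq (u * m %% P)%N | m <- iota 0 P]) F m).
  by rewrite big_map /index_iota subn0; apply: eq_bigr => m _; rewrite Fmod.
rewrite /index_iota subn0; apply: perm_big.
have map_uniq_iota : uniq [seq (u * m %% P)%N | m <- iota 0 P].
  rewrite map_inj_in_uniq ?iota_uniq // => x y.
  rewrite !mem_iota /= !add0n.
  wlog le_xy : x y / (x <= y)%N.
    by move=> wlg xP yP /esym e; case: (leqP x y) => [|/ltnW] le; [|symmetry]; apply: wlg.
  move=> xP yP /esym/eqP; rewrite eqn_mod_dvd ?leq_mul2l ?le_xy ?orbT //.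
  rewrite -mulnBr Gauss_dvdr // => /dvdnP[[|z] yx]; first by lia.
  have : (P <= y - x)%N by rewrite yx mulSn leq_addr.
  by lia.
apply: uniq_perm (iota_uniq _ _) _ => //.
apply: (uniq_min_size map_uniq_iota _ _).2; last by rewrite size_map.
by move=> _ /mapP[m _ ->]; rewrite mem_iota add0n ltn_pmod.
Qed.

(** Sorts the pairs of strands by their difference [j], which determines the factor [c j]. *)
Lemma sum_triangle N (G : nat -> nat -> int) :
  \sum_(0 <= k < N) \sum_(k.+1 <= l < N) G k l =
  \sum_(1 <= j < N) \sum_(0 <= k < N - j) G k (k + j)%N.
Proof.
transitivity (\sum_(0 <= k < N) \sum_(1 <= j < N | (k + j < N)%N) G k (k + j)%N).
  apply: eq_big_nat => k kN.
  rewrite -add1n big_addn (big_nat_widen 1 (N - k) N) ?leq_subr //=.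
  by apply: eq_big => [j|j _]; [lia|rewrite addnC].
rewrite (exchange_big_dep_nat predT) //=.
apply: eq_big_nat => j jN; rewrite [RHS](big_nat_widen 0 _ N) ?leq_subr //=.
by apply: eq_bigl => k; lia.
Qed.

(** As [k] grows by one, [k + (k + j)] grows by two, so consecutive windows abut. *)
Lemma sum_windows F a j n : {homo a : i k / (i <= k)%N} ->
  \sum_(0 <= k < n) \sum_(a (k + (k + j))%N <= m < a (k + (k + j)).+2%N) F m =
  \sum_(a j <= m < a (n + (n + j))%N) F m.
Proof.
move=> a_homo; elim: n => [|n IHn]; first by rewrite !big_geq.
rewrite big_nat_recr //= IHn.
rewrite [RHS](big_cat_nat (n := a (n + (n + j))%N)) /=; try by apply: a_homo; lia.
by rewrite !addSn addnS.
Qed.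

(* The windows of [j] and [N - j], the latter shifted by [q], tile [2q]
   consecutive integers. *)
Lemma sum_paired_windows N q a F c (s : int) : s * s = 1 ->
  {homo a : i k / (i <= k)%N} -> (forall i, a (i + N)%N = (a i + q)%N) ->
  (forall m, F (m + q)%N = s * F m) ->
  (forall j, (0 < j < N)%N -> c (N - j)%N = s * c j) ->
  2 * \sum_(1 <= j < N) c j * \sum_(a j <= m < a (N - j + N)%N) F m =
  (\sum_(1 <= j < N) c j) * \sum_(0 <= m < 2 * q) F m.
Proof.
move=> ss a_homo aN Fq cN.
(* One of the two copies of the sum is reversed, so that [j] meets [N - j]. *)
rewrite mulr_natl mulr2n {2}big_nat_rev -big_split /= mulr_suml.
apply: eq_big_nat => j /andP[j0 jN].
have NNj : (N - (N - j) = j)%N by lia.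
rewrite add1n subSS NNj cN ?j0 ?jN // -/(2 * q)%N.
have F2q m : F (m + 2 * q)%N = F m.
  by rewrite mul2n -addnn addnA !Fq mulrA ss mul1r.
rewrite -(sum_period1 F _ (a j)) //.
rewrite [in RHS](big_cat_nat (n := a (N - j + N)%N)) /=; last 2 first.
- by apply: a_homo; lia.
- rewrite mul2n -addnn addnA -!aN; apply: a_homo; lia.
rewrite mulrDr; congr (_ + _).
rewrite !aN mul2n -addnn addnA.
rewrite [in RHS]big_addn addnK -mulrA mulrCA mulr_sumr; congr (_ * _).
by apply: eq_bigr => m _; rewrite Fq.
Qed.
End NatSums.

(** * Trigonometric signs *)

Section Trigonometry.
Context {R : realType}.
Implicit Types x y : R.

Lemma sinDnpi x n : sin (x + n%:R * pi) = (-1) ^+ n * sin x.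
Proof. by rewrite mulr_natl (alternatingn (@sinDpi R)). Qed.

Lemma cosDnpi x n : cos (x + n%:R * pi) = (-1) ^+ n * cos x.
Proof. by rewrite mulr_natl (alternatingn (@cosDpi R)). Qed.

Lemma sin_eq0_npi x : 0 <= x -> sin x = 0 -> exists n : nat, x = n%:R * pi.
Proof.
move=> x0 sx0; have pi0 := @pi_gt0 R.
have /andP[] : (Num.trunc (x / pi))%:R <= x / pi < (Num.trunc (x / pi)).+1%:R.
  by apply: truncn_itv; rewrite divr_ge0 // ltW.
set n := Num.trunc _; rewrite ler_pdivlMr // ltr_pdivrMr // => lex ltx.
exists n; apply/eqP; rewrite eq_le lex andbT leNgt; apply/negP => nx.
have : 0 < sin (x - n%:R * pi).
  apply: sin_gt0_pi; rewrite subr_gt0 nx /=.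
  by move: ltx; rewrite -(natr1 n) mulrDl mul1r; lra.
move: sx0; rewrite -{1}(subrK (n%:R * pi) x) sinDnpi => /eqP.
by rewrite mulf_eq0 signr_eq0 /= => /eqP->; rewrite ltxx.
Qed.

Lemma cos_eq0_npi x : 0 <= x -> cos x = 0 ->
  exists n : nat, x = pi / 2 + n%:R * pi.
Proof.
have pi0 := @pi_gt0 R; move=> x0; rewrite -sinDpihalf => /sin_eq0_npi[|[|n] xn].
- by lra.
- by move: xn; rewrite mul0r; lra.
- by exists n; rewrite -[x](addrK (pi / 2)) xn -(natr1 n); field.
Qed.

Lemma sgz_sign n x : sgz ((-1) ^+ n * x) = (-1) ^+ n * sgz x.
Proof. by rewrite sgzM sgzX sgzN1. Qed.

(** Each multiple of [N] removed from [a] turns the angle by [pi] and flips the sign. *)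
Lemma sgz_sin_frac (N a : nat) : (0 < N)%N -> ~~ (N %| a)%N ->
  sgz (sin (pi * a%:R / N%:R) : R) = (-1) ^+ (a %/ N).
Proof.
move=> N0 Na; have N0' : (0 : R) < N%:R by rewrite ltr0n.
have -> : pi * a%:R / N%:R = pi * (a %% N)%:R / N%:R + (a %/ N)%:R * pi :> R.
  by rewrite {1}(divn_eq a N) natrD natrM; field; rewrite gt_eqF.
rewrite sinDnpi sgz_sign gtr0_sgz ?mulr1 //; apply: sin_gt0_pi.
have pi0 := @pi_gt0 R.
rewrite -mulrA; apply/andP; split.
  by rewrite mulr_gt0 ?divr_gt0 // ltr0n lt0n.
by rewrite gtr_pMr // ltr_pdivrMr // mul1r ltr_nat ltn_pmod.
Qed.

Lemma sinDB x y : sin (x + y) - sin (x - y) = 2 * (cos x * sin y).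
Proof. by rewrite sinD sinB; ring. Qed.

Lemma cosDB x y : cos (x + y) - cos (x - y) = - 2 * (sin x * sin y).
Proof. by rewrite cosD cosB; ring. Qed.

(* The angles [pi i / q + psi], for [i] in a suitable window of [q] consecutive
   integers, all lie in the upper half circle, where the signs alternate. *)
Lemma sum_alternating_half_turn (q : nat) (psi : R) : odd q ->
  (forall i : nat, sin (pi * i%:R / q%:R + psi) != 0) ->
  `|\sum_(0 <= i < q) (-1) ^+ i * sgz (sin (pi * i%:R / q%:R + psi))| = 1.
Proof.
move=> oq nz; have q0 : (0 < q)%N by case: q oq {nz}.
have q0' : (0 : R) < q%:R by rewrite ltr0n.
have pi0 := @pi_gt0 R.
pose e i : int := (-1) ^+ i * sgz (sin (pi * i%:R / q%:R + psi)).
have eq i : e (i + q)%N = e i.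
  rewrite /e; have -> : pi * (i + q)%:R / q%:R + psi =
      (pi * i%:R / q%:R + psi) + 1%:R * pi.
    by rewrite natrD; field; rewrite gt_eqF.
  by rewrite sinDnpi sgz_sign exprD mulrA -(signr_odd _ q) oq expr1 -mulrA; ring.
pose z := (Num.trunc (`|psi| / (2 * pi))).+1.
have zpsi : psi <= (2 * z)%:R * pi.
  rewrite natrM mulrAC -ler_pdivrMl ?mulr_gt0 // mulrC.
  apply: (le_trans (y := `|psi| / (2 * pi))).
    by rewrite ler_pM2r ?invr_gt0 ?mulr_gt0 // ler_norm.
  exact: ltW (truncnS_gt _).
(* The real index at which the angle equals [2 z pi], with [z] large enough to make it nonnegative.
   The window starts at the next integer [i0]. *)
pose x := ((2 * z)%:R * pi - psi) * q%:R / pi.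
have x0 : 0 <= x by rewrite /x divr_ge0 ?mulr_ge0 ?subr_ge0 // ltW.
pose i0 := (Num.trunc x).+1.
have [xi0 i0x] : x < i0%:R /\ i0%:R <= x + 1.
  by split; rewrite ?truncnS_gt // /i0 -(natr1 (Num.trunc x)) lerD2r truncn_le.
have e_sign i : (i < q)%N -> e (i0 + i)%N = (-1) ^+ (i0 + i).
  move=> iq; rewrite /e; have := nz (i0 + i)%N.
  have -> : pi * (i0 + i)%:R / q%:R + psi =
      pi * (i0%:R - x + i%:R) / q%:R + (2 * z)%:R * pi.
    rewrite natrD /x; have : (pi : R) != 0 by rewrite gt_eqF.
    by move: (pi : R) => c c0; field; rewrite c0 gt_eqF.
  rewrite sinDnpi mulnC exprM sqrr_sign mul1r => nz'.
  (* The estimates do not keep the angle away from [pi]; [nz'] does. *)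
  rewrite gtr0_sgz ?mulr1 // lt_neqAle eq_sym nz' /=; apply: sin_ge0_pi.
  have i0' : (0 : R) <= i%:R by [].
  apply/andP; split.
    by rewrite divr_ge0 ?mulr_ge0 ?(ltW pi0) ?(ltW q0') //; lra.
  rewrite ler_pdivrMr // ler_pM2l //.
  have : (i.+1%:R : R) <= q%:R by rewrite ler_nat.
  by rewrite -(natr1 i); lra.
suff : `|\sum_(0 <= i < q) e i| = 1 by [].
have := sum_period1 e q i0 eq; rewrite addnC -{1}(add0n i0) big_addn addnK => <-.
rewrite (eq_big_nat _ _ (F2 := fun i => (-1) ^+ i0 * (-1) ^+ i)); last first.
  by move=> i iq; rewrite addnC e_sign // exprD.
rewrite -mulr_sumr normrM normrX normrN1 expr1n mul1r.
(* The alternating signs cancel in pairs, and the last one is left over. *)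
have {oq} -> : q = (q./2 * 2).+1 by rewrite muln2 -[LHS]odd_double_half oq.
rewrite big_nat_recr //= exprM sqrr_sign.
suff -> : \sum_(0 <= i < q./2 * 2) (-1) ^+ i = 0 :> int by rewrite add0r.
apply: (sum_antiperiod (fun i => (-1) ^+ i) 1 0 q./2) => m.
by rewrite exprD expr1 mulrN1.
Qed.
End Trigonometry.

(** * Sums of the level signs over a period *)

Section LevelSigns.
Context {R : realType}.
Implicit Types (p q m : nat) (phi : R).

(** The factor [f m] of a crossing sign, common to all pairs of strands; [phi] is the angle
    contributed by the phase. *)
Definition level_sign p q phi m : int :=
  (-1) ^+ m * sgz (sin (pi * (p * (2 * m + 1))%:R / (2 * q)%:R + phi)).

Lemma level_signD p q phi m : (0 < q)%N ->
  level_sign p q phi (m + q) = (-1) ^+ (p + q) * level_sign p q phi m.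
Proof.
move=> q0; rewrite /level_sign.
have -> : pi * (p * (2 * (m + q) + 1))%:R / (2 * q)%:R + phi =
    (pi * (p * (2 * m + 1))%:R / (2 * q)%:R + phi) + p%:R * pi :> R.
  by rewrite !(natrM, natrD); field; rewrite pnatr_eq0 -lt0n.
by rewrite sinDnpi sgz_sign !exprD; ring.
Qed.

Lemma level_signM d p q phi m : (0 < d)%N -> (0 < q)%N ->
  level_sign (d * p) (d * q) phi m = level_sign p q phi m.
Proof.
move=> d0 q0; rewrite /level_sign; congr (_ * sgz (sin (_ + _))).
by rewrite !natrM; field; rewrite !pnatr_eq0 -!lt0n q0.
Qed.

(** As [p] is odd, the sign at [m] is the term of index [p * m] of the alternating sum over
    equidistant angles. As [q] is odd, these terms have period [q], and multiplication by [p] only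
    permutes them. *)
Lemma sum_level_sign_coprime p q phi : odd p -> odd q -> coprime p q ->
  (forall m, level_sign p q phi m != 0) ->
  `|\sum_(0 <= m < q) level_sign p q phi m| = 1.
Proof.
move=> op oq cpq nz.
have p0 : (0 < p)%N by case: (p) op.
have q0 : (0 < q)%N by case: (q) oq.
pose psi : R := pi * p%:R / (2 * q)%:R + phi.
pose e i : int := (-1) ^+ i * sgz (sin (pi * i%:R / q%:R + psi)).
have shift i k : sin (pi * (i + k * q)%:R / q%:R + psi) =
    (-1) ^+ k * sin (pi * i%:R / q%:R + psi).
  rewrite -sinDnpi natrD natrM; congr sin.
  by field; rewrite pnatr_eq0 -lt0n.
have lE m : level_sign p q phi m = e (p * m)%N.
  rewrite /level_sign /e exprM -(signr_odd _ p) op expr1; congr (_ * sgz (sin _)).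
  by rewrite /psi !(natrM, natrD); field; rewrite pnatr_eq0 -lt0n.
(* Modulo [q] every index [i] is a multiple of [p], hence comes from a level. *)
have nzs i : sin (pi * i%:R / q%:R + psi) != 0.
  case: (egcdnP q p0) => u v; rewrite (eqP cpq) => uv _.
  have := nz (u * i)%N; rewrite lE /e mulf_eq0 signr_eq0 /= sgz_eq0.
  have -> : (p * (u * i) = i + v * i * q)%N
    by rewrite mulnA (mulnC p) uv mulnDl mul1n addnC mulnAC.
  by rewrite shift mulf_eq0 signr_eq0.
rewrite -(sum_alternating_half_turn q psi oq nzs); congr `|_|.
under eq_bigr do rewrite lE.
rewrite (sum_period_coprime e) ?(coprime_sym q) // => m.
have := shift m 1%N; rewrite mul1n /e => ->; rewrite sgz_sign exprD -(signr_odd _ q) oq.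
by rewrite expr1; ring.
Qed.

Lemma sum_level_sign p q phi : (0 < p)%N -> (0 < q)%N ->
  (forall m, level_sign p q phi m != 0) ->
  `|\sum_(0 <= m < 2 * q) level_sign p q phi m| =
  2 * (gcdn p q)%:Z * (2 * gcdn p q %| p + q)%N%:Z.
Proof.
move=> p0 q0 nz; set d := gcdn p q.
have d0 : (0 < d)%N by rewrite gcdn_gt0 p0.
have := divnK (dvdn_gcdl p q); have := divnK (dvdn_gcdr p q).
rewrite -/d; set q' := (q %/ d)%N; set p' := (p %/ d)%N.
rewrite (mulnC q') (mulnC p') => dq dp.
have q'0 : (0 < q')%N by move: q0; rewrite -dq muln_gt0 d0.
have cpq : coprime p' q'.
  by rewrite /coprime -(eqn_pmul2l d0) muln1 muln_gcdr dp dq.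
have lE m : level_sign p q phi m = level_sign p' q' phi m.
  by rewrite -[RHS](level_signM d) // dp dq.
have lD m := level_signD p' q' phi m q'0.
have -> : (2 * d %| p + q)%N = ~~ odd (p' + q').
  by rewrite -dp -dq -mulnDr mulnC dvdn_pmul2l // dvdn2.
under eq_bigr do rewrite lE.
have -> : (2 * q = 0 + d * (q' + q'))%N by lia.
case opq : (odd (p' + q')) => /=.
  rewrite mulr0 sum_antiperiod ?normr0 // => m.
  by rewrite lD -signr_odd opq expr1 mulN1r.
have [op oq] : odd p' /\ odd q'.
  move: opq; rewrite oddD; case op: (odd p'); case oq: (odd q') => // _.
  have : (2 %| gcdn p' q')%N by rewrite dvdn_gcd !dvdn2 op oq.
  by rewrite (eqP cpq).
have -> : (d * (q' + q') = 2 * d * q')%N by lia.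
rewrite sum_period => [|m]; last by rewrite lD -signr_odd opq mul1r.
by rewrite normrM sum_level_sign_coprime // => m; rewrite -lE.
Qed.
End LevelSigns.

(** * Crossings of the minimal braid *)

(** The factor [c j], with the signs of the sines read off by [sgz_sin_frac]. *)
Definition floor_sign (N p q j : nat) : int := (-1) ^+ (p * j %/ N + q * j %/ N).

(** Here [s] is the sum [k + l] of the indices of the two strands. *)
Definition crossing_time {R : realType} (N q s m : nat) : R :=
  N%:R * (2 * m + 1)%:R / (4 * q)%:R - s%:R / 2.

(* [crossing_time N q s m <= eta] solved for [m]. *)
Definition crossing_count {R : realType} (N q : nat) (eta : R) (s : nat) : nat :=
  Num.trunc (q%:R * (2 * eta + s%:R) / N%:R + 1 / 2).

Section Crossings.
Context {R : realType}.
Variables (N p q : nat) (eps eta : R).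
Hypotheses (N0 : (0 < N)%N) (q0 : (0 < q)%N).
Hypotheses (cNp : coprime N p) (cNq : coprime N q).
Implicit Types (k l : 'I_N) (t : R).

Let N0' : (N%:R : R) != 0. Proof. by rewrite pnatr_eq0 -lt0n. Qed.
Let q0' : (q%:R : R) != 0. Proof. by rewrite pnatr_eq0 -lt0n. Qed.
Let phi : R := 2 * pi / N%:R * (p%:R * eps).

(** Half sums and half differences of the angles of two strands, for use with the sum-to-product
    formulas. *)
Let mean_x k l t : R := pi * q%:R * (2 * t + (k + l)%:R) / N%:R.
Let mean_y k l t : R := pi * p%:R * (2 * t + (k + l)%:R + 2 * eps) / N%:R.
Let gap r k l : R := pi * (r * (l - k))%:R / N%:R.

Lemma strand_x_mean k l t : (k < l)%N ->
  2 * pi / N%:R * (q%:R * (t + k%:R)) = mean_x k l t - gap q k l /\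
  2 * pi / N%:R * (q%:R * (t + l%:R)) = mean_x k l t + gap q k l.
Proof.
move=> kl; rewrite /mean_x /gap natrM (natrB _ (ltnW kl)) natrD.
by split; field.
Qed.

Lemma strand_y_mean k l t : (k < l)%N ->
  2 * pi / N%:R * (p%:R * (t + k%:R + eps)) = mean_y k l t - gap p k l /\
  2 * pi / N%:R * (p%:R * (t + l%:R + eps)) = mean_y k l t + gap p k l.
Proof.
move=> kl; rewrite /mean_y /gap natrM (natrB _ (ltnW kl)) natrD.
by split; field.
Qed.

Lemma sgz_sin_gap r k l : coprime N r -> (k < l)%N ->
  sgz (sin (gap r k l)) = (-1) ^+ (r * (l - k) %/ N).
Proof.
move=> cNr kl; rewrite sgz_sin_frac // coprime_Ndvd //.
by have := ltn_ord l; lia.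
Qed.

Lemma mean_x_crossing_time k l m :
  mean_x k l (crossing_time N q (k + l) m) = pi / 2 + m%:R * pi.
Proof.
by rewrite /mean_x /crossing_time !(natrM, natrD); field; rewrite q0' N0'.
Qed.

Lemma mean_y_crossing_time k l m :
  mean_y k l (crossing_time N q (k + l) m) =
  pi * (p * (2 * m + 1))%:R / (2 * q)%:R + phi.
Proof.
by rewrite /mean_y /crossing_time /phi !(natrM, natrD); field; rewrite q0' N0'.
Qed.

(** The difference of the two sines is [2 cos mean_x sin gap] up to sign, and the second sine is
    nonzero by coprimality. That [t] is nonnegative makes the index [m] of the zero of the cosine a
    natural number. *)
Lemma strand_x_eq k l t : (k < l)%N -> 0 <= t ->
  strand_x q k t = strand_x q l t <->
  exists m, t = crossing_time N q (k + l) m.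
Proof.
move=> kl t0; have [xk xl] := strand_x_mean k l t kl.
rewrite /strand_x xk xl.
have : sin (gap q k l) != 0.
  by rewrite -sgz_eq0 sgz_sin_gap // signr_eq0.
move=> gap0; split=> [e|[m tm]].
  have : 2 * (cos (mean_x k l t) * sin (gap q k l)) = 0.
    by rewrite -sinDB e subrr.
  move=> /eqP; rewrite !mulf_eq0 pnatr_eq0 /= (negbTE gap0) orbF => /eqP.
  case/cos_eq0_npi => [|m em].
    rewrite /mean_x divr_ge0 // mulr_ge0 //; first by rewrite mulr_ge0 ?pi_ge0.
    by rewrite addr_ge0 // mulr_ge0.
  exists m; have : mean_x k l t = mean_x k l (crossing_time N q (k + l) m).
    by rewrite mean_x_crossing_time.
  have c0 : 2 * pi * q%:R / N%:R != 0 :> R.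
    by rewrite !mulf_neq0 ?invr_eq0 // gt_eqF // pi_gt0.
  rewrite /mean_x => e'; apply: (mulfI c0); apply: (addIr (pi * q%:R * (k + l)%:R / N%:R)).
  transitivity (pi * q%:R * (2 * t + (k + l)%:R) / N%:R); first by field.
  by rewrite e'; field.
apply: esym; apply/eqP; rewrite -subr_eq0 sinDB tm mean_x_crossing_time.
by rewrite cosDnpi cos_pihalf mulr0 mul0r mulr0.
Qed.

Lemma derive1_strand_x k t :
  (strand_x q k)^`()%classic t =
  2 * pi / N%:R * q%:R * cos (2 * pi / N%:R * (q%:R * (t + k%:R))).
Proof.
rewrite derive1E.
have d : is_derive t 1 (fun u => 2 * pi / N%:R * (q%:R * (u + k%:R)) : R)
    (2 * pi / N%:R * q%:R).
  rewrite (_ : (fun u : R => _) =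
    (2 * pi / N%:R * q%:R) \*: ((id : R -> R) + cst (k%:R : R))).
    by apply: is_derive_eq; rewrite addr0 scaler1.
  by apply/funext => u; rewrite /= mulrA.
have ds := is_derive1_comp (is_derive_sin _) d.
by rewrite (@derive_val _ _ _ _ _ _ _ ds) mulrC.
Qed.

(** Both the velocity difference and the height difference are differences of cosines, hence
    products of sines of a mean and a gap; at the crossing the sine of [mean_x] is [(-1)^m]. *)
Lemma crossing_signE k l m : (k < l)%N ->
  crossing_sign p q eps (k, l, crossing_time N q (k + l) m) =
  floor_sign N p q (l - k) * level_sign p q phi m.
Proof.
move=> kl; set t := crossing_time N q (k + l) m.
have [xk xl] := strand_x_mean k l t kl.
have [yk yl] := strand_y_mean k l t kl.
rewrite /crossing_sign !derive1_strand_x /strand_y xk xl yk yl.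
rewrite -mulrBr -opprB cosDB -(opprB (cos (_ + _))) cosDB.
rewrite !mean_x_crossing_time mean_y_crossing_time.
rewrite sinDnpi sin_pihalf mulr1 !(sgzM, sgzN).
have sgz_pos (x : R) : 0 < x -> sgz x = 1 by apply: gtr0_sgz.
rewrite !sgz_sin_gap // sgzX sgzN1 (sgz_pos 2) // (sgz_pos pi) ?pi_gt0 //.
rewrite (sgz_pos N%:R^-1) ?invr_gt0 ?ltr0n // (sgz_pos q%:R) ?ltr0n //.
by rewrite /floor_sign /level_sign exprD; ring.
Qed.

Hypothesis eta_gt0 : 0 < eta.
Hypothesis eta_irr : irrational eta.

Lemma crossing_timeD2 s m :
  crossing_time N q s.+2 m = crossing_time N q s m - 1 :> R.
Proof. by rewrite /crossing_time -addn2 natrD; field. Qed.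

Lemma crossing_time_neq s m : crossing_time N q s m != eta.
Proof.
apply/eqP => e; apply: eta_irr.
exists (N%:R * (2 * m + 1)%:R / (4 * q)%:R - s%:R / 2) => //.
rewrite -e /crossing_time.
by rewrite rmorphB !rmorphM !fmorphV !rmorph_nat.
Qed.

Lemma crossing_countP s m :
  (m < crossing_count N q eta s)%N = (crossing_time N q s m <= eta).
Proof.
have Np : (0 : R) < N%:R by rewrite ltr0n.
rewrite truncn_gt_nat -lerBlDr ler_pdivlMr // /crossing_time lerBlDr.
rewrite ler_pdivrMr ?ltr0n ?muln_gt0 // -(natr1 m) !(natrM, natrD).
by apply/idP/idP; lra.
Qed.

Lemma crossing_count_homo : {homo crossing_count N q eta : s r / (s <= r)%N}.
Proof.
move=> s r sr; apply: le_truncn; rewrite lerD2r ler_pM2r ?invr_gt0 ?ltr0n //.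
by rewrite ler_pM2l ?ltr0n // lerD2l ler_nat.
Qed.

Lemma crossing_countD s :
  crossing_count N q eta (s + N) = (crossing_count N q eta s + q)%N.
Proof.
have y0 : (0 : R) <= q%:R * (2 * eta + s%:R) / N%:R + 1 / 2.
  by rewrite addr_ge0 ?divr_ge0 ?mulr_ge0 ?addr_ge0 ?mulr_ge0 ?(ltW eta_gt0).
rewrite /crossing_count (_ : _ * _ / _ + _ =
  q%:R * (2 * eta + s%:R) / N%:R + 1 / 2 + q%:R).
  by rewrite addrC truncnD ?natrK 1?addnC // natr_nat.
by rewrite natrD; field.
Qed.

Lemma crossing_time_inj s : injective (crossing_time N q s : nat -> R).
Proof.
move=> m m' /addIr; rewrite -!mulrA => /(mulfI N0').
move=> /mulIf; rewrite invr_eq0 pnatr_eq0 => /(_ _)/eqP.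
by rewrite eqr_nat => /(_ _)/eqP; lia.
Qed.

(** Raising [s] by two moves the crossing time back by one. The counts exclude the time [eta]
    itself, which is harmless: crossing times are rational and [eta] is not. *)
Lemma mem_window s m :
  (crossing_count N q eta s <= m < crossing_count N q eta s.+2)%N =
  (crossing_time N q s m \in `[eta, 1 + eta]).
Proof.
rewrite leqNgt !crossing_countP crossing_timeD2 [_ - 1 <= _]lerBlDl -ltNge.
by rewrite lt_neqAle eq_sym crossing_time_neq in_itv.
Qed.

(** The crossing points are listed without repetition by pairs of strands and levels; for each
    difference [j] the windows of levels then merge into one. *)
Lemma writheE :
  writhe N p q eps eta = \sum_(1 <= j < N) floor_sign N p q j *
    \sum_(crossing_count N q eta j <= m < crossing_count N q eta (N - j + N))
      level_sign p q phi m.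
Proof.
pose c := crossing_count N q eta.
pose pairs := [seq kl : 'I_N * 'I_N <- enum {: 'I_N * 'I_N} | (kl.1 < kl.2)%N].
pose times (kl : 'I_N * 'I_N) :=
  index_iota (c (kl.1 + kl.2)%N) (c (kl.1 + kl.2).+2).
pose point (kl : 'I_N * 'I_N) m : 'I_N * 'I_N * R :=
  (kl, crossing_time N q (kl.1 + kl.2) m).
pose r := [seq point kl m | kl <- pairs, m <- times kl].
have rE : crossing_points q eta = [set` r]%classic.
  apply/seteqP; split=> [[[k l] t]|[[k l] t]] /=.
  - move=> [/= kl t_in e].
    have [m tm] : exists m, t = crossing_time N q (k + l) m.
      apply/strand_x_eq => //; move: t_in; rewrite in_itv => /andP[et _].
      exact: le_trans (ltW eta_gt0) et.
    apply/allpairsPdep; exists (k, l), m; split; last by rewrite /= tm.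
      by rewrite mem_filter /= kl mem_enum.
    by rewrite mem_index_iota mem_window -tm.
  - move=> /allpairsPdep[[k' l'] [m /= [+ + [-> -> ->]]]].
    rewrite mem_filter /= mem_index_iota mem_window => /andP[kl _] t_in.
    split=> //=; apply/strand_x_eq => //; last by exists m.
    move: t_in; rewrite in_itv => /andP[et _].
    exact: le_trans (ltW eta_gt0) et.
have r_uniq : uniq r.
  apply: allpairs_uniq_dep.
  - by rewrite filter_uniq ?enum_uniq.
  - by move=> kl _; apply: iota_uniq.
  move=> [kl m] [kl' m'] _ _ /= [<- e].
  by have -> := crossing_time_inj _ _ _ e.
rewrite /writhe rE -fsbig_seq // big_allpairs_dep big_filter /=.
transitivity (\sum_(0 <= k < N) \sum_(k.+1 <= l < N) floor_sign N p q (l - k) *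
    \sum_(c (k + l)%N <= m < c (k + l).+2) level_sign p q phi m).
  rewrite big_mkord big_enum_cond /=.
  under [RHS]eq_bigr do rewrite big_geq_mkord.
  rewrite pair_big_dep /=; apply: eq_bigr => -[k l] /= kl.
  rewrite mulr_sumr; apply: eq_bigr => m _.
  exact: crossing_signE.
rewrite sum_triangle; apply: eq_big_nat => j jN.
under [LHS]eq_bigr do rewrite addKn.
rewrite -mulr_sumr; congr (_ * _).
rewrite sum_windows; last exact: crossing_count_homo.
by congr (\sum_(_ <= m < c _) _); lia.
Qed.

(* Were a level to vanish, two strands would meet at a crossing of
   neighbouring strands [k], [k + 1] on that level. *)
Lemma level_sign_neq0 m : (1 < N)%N -> admissible_phase N p q eps eta ->
  level_sign p q phi m != 0.
Proof.
move=> N1 adm; pose c := crossing_count N q eta.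
have c_homo : {homo c : s r / (s <= r)%N} := crossing_count_homo.
(* The windows of the neighbours [k], [k + 1] have index sum [2 k + 1] and abut. *)
have strip n i : (c 1 <= i < c (n + n).+1)%N ->
    exists2 k, (k < n)%N & (c (k + k).+1 <= i < c (k + k).+3)%N.
  elim: n => [|n IHn]; first by rewrite addn0 ltnNge andbN.
  rewrite addSn addnS => /andP[c1 ci].
  case: (leqP (c (n + n).+1) i) => ci'; first by exists n; rewrite // ci' ci.
  by have [|k kn ck] := IHn; [rewrite c1 | exists k => //; apply: ltnW].
have nz1 i : (c 1 <= i < c 1 + q)%N -> level_sign p q phi i != 0.
  (* The [N - 1] neighbouring pairs reach up to [c (2 N - 1)], which is at least
     [c (N + 1) = c 1 + q]. *)
  move=> /andP[c1 ci]; have [|k kN ck] := strip N.-1 i.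
    rewrite c1 (leq_trans ci) // /c -crossing_countD add1n.
    by apply: c_homo; lia.
  have kN' : (k < N)%N by lia.
  have kN1 : (k.+1 < N)%N by lia.
  pose K := Ordinal kN'; pose L := Ordinal kN1.
  have KL : (K < L)%N by [].
  have tI : crossing_time N q (K + L) i \in `[eta, 1 + eta].
    by rewrite -mem_window /= addnS.
  apply/negP => lev0; suff : K = L by move/(congr1 val) => /=; lia.
  apply: (adm _ tI); congr (_, _).
    apply/strand_x_eq => //; last by exists i.
    by move: tI; rewrite in_itv => /andP[/(le_trans (ltW eta_gt0))].
  have [yk yl] := strand_y_mean K L (crossing_time N q (K + L) i) KL.
  rewrite /strand_y yk yl; apply/esym/eqP; rewrite -subr_eq0 cosDB.
  move: lev0; rewrite mean_y_crossing_time /level_sign mulf_eq0 signr_eq0 /=.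
  by rewrite sgz_eq0 => /eqP->; rewrite mul0r mulr0.
have nzq i n : (level_sign p q phi (i + n * q) == 0) = (level_sign p q phi i == 0).
  elim: n => [|n IHn]; first by rewrite addn0.
  by rewrite mulSnr addnA level_signD // mulf_eq0 signr_eq0 IHn.
(* A level in the covered range congruent to [m] modulo [q]; the summand [c 1 * q] keeps the
   subtraction from truncating. *)
have := nz1 (c 1 + (m + c 1 * q - c 1) %% q)%N.
rewrite leq_addr ltn_add2l ltn_pmod // => /(_ isT).
rewrite -(nzq _ ((m + c 1%N * q - c 1%N) %/ q)%N) -addnA (addnC (_ %% q)%N) -divn_eq.
by rewrite subnKC ?nzq //; nia.
Qed.

(** Passing from [j] to [N - j] multiplies [c j] by [(-1)^(p + q)], the same factor by which [f]
    changes under a shift by [q]. *)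
Lemma double_writhe : (1 < N)%N -> 2 * writhe N p q eps eta =
  (\sum_(1 <= j < N) floor_sign N p q j) *
  \sum_(0 <= m < 2 * q) level_sign p q phi m.
Proof.
move=> N1; rewrite writheE.
apply: (sum_paired_windows N q _ _ _ ((-1) ^+ (p + q))).
- by rewrite -expr2 sqrr_sign.
- exact: crossing_count_homo.
- exact: crossing_countD.
- by move=> m; rewrite level_signD.
move=> j jN; rewrite /floor_sign -exprD -[LHS]signr_odd -[RHS]signr_odd; congr (_ ^+ nat_of_bool _).
have odd_reflect r : coprime N r ->
    odd (r * (N - j) %/ N) = odd r (+) ~~ odd (r * j %/ N).
  move=> c; have r0 : (0 < r)%N.
    by case: r c => //; rewrite /coprime gcdn0; lia.
  have := @divn_reflect N (r * j) (r * (N - j)) r N0 (coprime_Ndvd N r j c jN).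
  rewrite -mulnDr subnKC 1?mulnC; last by lia.
  move=> /(_ erefl)/(congr1 odd).
  by case: r r0 {c} => // r _ /=; rewrite oddD; do 3![case: odd].
rewrite !oddD !odd_reflect //.
by do 4![case: odd].
Qed.
End Crossings.

(** * The sum of the signs [c j] and the bounds on the writhe *)

Lemma sum_floor_sign (N p q : nat) :
  (1 < N)%N -> coprime N p -> coprime N q ->
  `|\sum_(1 <= j < N) floor_sign N p q j| = N%:Z - 1 /\
    ((2 * N %| p + q)%N || (p == q %[mod 2 * N])%N) \/
  `|\sum_(1 <= j < N) floor_sign N p q j| <= N%:Z - 3 /\
    ~~ ((2 * N %| p + q)%N || (p == q %[mod 2 * N])%N).
Proof.
move=> N1 cp cq; have cst := floor_parity_const N p q N1 cp cq.
have sgnE (a b : bool) : ((-1) ^+ a == (-1) ^+ b :> int) = (a == b).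
  by case: a; case: b.
have c_cst (e : int) : {in index_iota 1 N, forall j, floor_sign N p q j = e} ->
    (2 * N %| p + q)%N || (p == q %[mod 2 * N])%N.
  move=> ce; apply/orP; have [|->|/eqP->] := cst.1; [|by left|by right].
  exists (odd (p * 1 %/ N + q * 1 %/ N)) => j jN; apply/eqP.
  rewrite -sgnE !signr_odd -/(floor_sign N p q j) -/(floor_sign N p q 1).
  by rewrite !ce // mem_index_iota.
have norm_cst (e : int) : `|e| = 1 ->
    {in index_iota 1 N, forall j, floor_sign N p q j = e} ->
    `|\sum_(1 <= j < N) floor_sign N p q j| = N%:Z - 1.
  move=> e1 ce; rewrite (eq_big_seq (fun=> e)) // sumr_const_nat normrMn e1.
  by rewrite natz; lia.
have := sum_signs _ (index_iota 1 N) (floor_sign N p q).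
case=> [j _|[e e1 ce]|le]; first by rewrite normrX normrN1 expr1n.
  by left; split; [apply: norm_cst e1 ce | apply: c_cst ce].
have {}le : `|\sum_(1 <= j < N) floor_sign N p q j| <= N%:Z - 3.
  by apply: le_trans le _; rewrite size_iota; lia.
right; split=> //; apply/negP => /orP div.
have [b Hb] : exists b, forall j, (0 < j < N)%N ->
    odd (p * j %/ N + q * j %/ N) = b.
  by apply/cst; case: div => [->|/eqP->]; [left|right].
have : `|\sum_(1 <= j < N) floor_sign N p q j| = N%:Z - 1.
  apply: (norm_cst ((-1) ^+ b)); first by rewrite normrX normrN1 expr1n.
  by move=> j; rewrite mem_index_iota => jN; rewrite -(Hb j jN) signr_odd.
by lia.
Qed.

(* The conjunct [2 * gcdn p q %| p + q] of the equality case is automatic when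
   gcd(p, q) is odd.  It cannot be dropped: for N = 3, p = 4, q = 8 one has
   2N | p + q, but the writhe is 0 (if p/d and q/d have opposite parities, the
   time shift by N/(2d) negates exactly one of the two coordinates). *)
Theorem corollary1 (R : realType) (N p q : nat) (eps eta : R)
    (hN : (2 <= N)%N) (hp : (N < p)%N) (hq : (N < q)%N)
    (hNp : coprime N p) (hNq : coprime N q)
    (eta_gt0 : 0 < eta) (eta_irr : irrational eta)
    (heps : admissible_phase N p q eps eta) :
  let d : int := (gcdn p q)%:Z in
  let w : int := writhe N p q eps eta in
  let extremal : Prop :=
    (((2 * N)%:Z %| p%:Z + q%:Z)%Z \/ ((2 * N)%:Z %| p%:Z - q%:Z)%Z)
    /\ (2 * d %| p%:Z + q%:Z)%Z in
  [/\ `|w| <= d * (N%:Z - 1),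
      `|w| = d * (N%:Z - 1) <-> extremal &
      ~ extremal -> `|w| <= d * (N%:Z - 3)].
Proof.
move=> d w extremal.
have N0 : (0 < N)%N by lia.
have p0 : (0 < p)%N by lia.
have q0 : (0 < q)%N by lia.
have d0 : (0 < gcdn p q)%N by rewrite gcdn_gt0 p0.
set T := \sum_(1 <= j < N) floor_sign N p q j.
set b := (2 * gcdn p q %| p + q)%N.
have wE : `|w| = d * b%:Z * `|T|.
  have := double_writhe N p q eps eta N0 q0 hNp hNq eta_gt0 eta_irr hN.
  move/(congr1 Num.norm); rewrite !normrM sum_level_sign //; last first.
    by move=> m; apply: (level_sign_neq0 N p q eps eta).
  by rewrite -/T -/w -/b -/d; lia.
have extE : extremal <->
    ((2 * N %| p + q)%N || (p == q %[mod 2 * N])%N) /\ b.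
  rewrite /extremal -eqz_mod_dvd !modz_nat eqz_nat -!PoszD !dvdzE /=.
  rewrite -/b.
  by split=> -[/orP].
(* For [N = 2] the bound [d (N - 3)] is negative, so a vanishing writhe must be excluded: [d] is odd
   and [p + q] is even. *)
have b2 : (N < 3)%N -> b.
  move=> N3; have N2 : N = 2 by lia.
  move: hNp hNq; rewrite N2 !coprime2n => op oq.
  have od : odd (gcdn p q).
    by apply: dvdn_odd (dvdn_gcdl p q) op.
  rewrite /b Gauss_dvd ?coprime2n // dvdn2 oddD op oq /=.
  by rewrite dvdn_add ?dvdn_gcdl ?dvdn_gcdr.
have := sum_floor_sign N p q hN hNp hNq; rewrite -/T => TE.
have d1 : 0 < d by rewrite /d; lia.
rewrite wE; case: (b) b2 extE => b2 extE.
- rewrite mulr1; case: TE => -[TE c].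
    rewrite TE; split=> //; first by split=> // _; apply/extE.
    by case; apply/extE.
  have nextr : ~ extremal by rewrite extE (negbTE c) => -[].
  split=> [||_]; last by rewrite ler_pM2l.
    by rewrite ler_pM2l // (le_trans TE) // lerD2l.
  by split=> // /(mulfI (lt0r_neq0 d1)) TN; move: TE; rewrite TN lerD2l.
(* Here the writhe vanishes, and [N >= 3] makes both bounds nonnegative and the first one
   positive. *)
- have N3 : (2 < N)%N by rewrite ltnNge; apply/negP => /b2.
  have nextr : ~ extremal by rewrite extE => -[].
  rewrite mulr0 mul0r; split=> [||_].
  + by rewrite mulr_ge0 ?(ltW d1) // subr_ge0 lez_nat.
  + by split=> // /esym/eqP; rewrite mulf_eq0 (gt_eqF d1) subr_eq0 eqz_nat gtn_eqF.
  + by rewrite mulr_ge0 ?(ltW d1) // subr_ge0 lez_nat.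
Qed.
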